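(* For any deterministic algorithm with only the first-order oracle, there exists a $1$-Lipschitz function $f:\mathbb{R}^d\to[-1,1]$ such that the algorithm cannot find a $(\delta,\epsilon)$-Goldstein stationary point of $f$ in a finite number of iterations for any $0<\delta<\epsilon<1$.
   Context: Here $d\ge 1$ is a fixed finite dimension and all norms are Euclidean. For a Lipschitz function $f:\mathbb{R}^d\to\mathbb{R}$, the Clarke subdifferential $\partial f(\mathbf{x})$ is the convex hull of all limits of $\nabla f(\mathbf{x}_k)$ along sequences $\mathbf{x}_k\to\mathbf{x}$ of differentiability points of $f$; its elements are called Clarke subgradients. For $\delta>0$, the $\delta$-Goldstein subdifferential is $\partial_\delta f(\mathbf{x})=\mathrm{conv}\big(\bigcup_{\mathbf{y}:\|\mathbf{y}-\mathbf{x}\|\le\delta}\partial f(\mathbf{y})\big)$. A point $\mathbf{x}$ is a $(\delta,\epsilon)$-Goldstein stationary point of $f$ if $\min\{\|\mathbf{g}\|:\mathbf{g}\in\partial_\delta f(\mathbf{x})\}\le\epsilon$. A deterministic algorithm with only the first-order oracle accesses $f$ only by querying points sequentially. At a queried point $\mathbf{x}$ the oracle returns a Clarke subgradient $\mathbf{g}\in\partial f(\mathbf{x})$, chosen without taking global information on $f$ into account, and returns no function value. Each query point is a deterministic function of the initial point and the previous oracle answers. After finitely many queries the algorithm may return a candidate point for being a $(\delta,\epsilon)$-Goldstein stationary point, and this candidate need not be one of the queried points. *)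

(* Defs.v *)
From HB Require Import structures.
From mathcomp Require Import all_boot all_order all_algebra.
From mathcomp Require Import all_classical all_reals all_analysis.

Set Implicit Arguments.
Unset Strict Implicit.
Unset Printing Implicit Defensive.

Import Order.TTheory GRing.Theory Num.Theory.
Import numFieldNormedType.Exports.

Local Open Scope classical_set_scope.
Local Open Scope ring_scope.

(* The library norm of 'rV[R]_d is the sup norm: it induces the Euclidean
   topology, and hence the right notions of convergence and differentiability,
   but Lipschitz constants, balls and lengths have to be measured by [enorm]. *)
Definition enorm (R : realType) (d : nat) (x : 'rV[R]_d) : R :=
  Num.sqrt (\sum_i x 0 i ^+ 2).

Definition elipschitz (R : realType) (d : nat) (k : R) (f : 'rV[R]_d -> R) :=
  forall x y, `|f x - f y| <= k * enorm (x - y).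

Definition gradient (R : realType) (d : nat) (f : 'rV[R]_d -> R)
    (x : 'rV[R]_d) : 'rV[R]_d :=
  \row_i 'D_(delta_mx 0 i) f x.

Definition conv_hull (R : realType) (d : nat) (S : set 'rV[R]_d) :
    set 'rV[R]_d :=
  smallest (@convex_set R 'rV[R]_d) S.

Definition limiting_gradients (R : realType) (d : nat) (f : 'rV[R]_d -> R)
    (x : 'rV[R]_d) : set 'rV[R]_d :=
  [set g | exists u : nat -> 'rV[R]_d,
    [/\ forall k, differentiable f (u k),
        u @ \oo --> x &
        (fun k => gradient f (u k)) @ \oo --> g]].

Definition clarke (R : realType) (d : nat) (f : 'rV[R]_d -> R)
    (x : 'rV[R]_d) : set 'rV[R]_d :=
  conv_hull (limiting_gradients f x).

Definition goldstein (R : realType) (d : nat) (delta : R) (f : 'rV[R]_d -> R)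
    (x : 'rV[R]_d) : set 'rV[R]_d :=
  conv_hull (\bigcup_(y in [set y | enorm (y - x) <= delta]) clarke f y).

(* For Lipschitz f the set [goldstein delta f x] is compact and nonempty, so
   the infimum is a minimum; the infimum of the empty set is +oo. *)
Definition goldstein_stationary (R : realType) (d : nat) (delta eps : R)
    (f : 'rV[R]_d -> R) (x : 'rV[R]_d) : Prop :=
  (ereal_inf [set (enorm g)%:E | g in goldstein delta f x] <= eps%:E)%E.

(* [O f x] is the answer to the query x when the objective function is f. *)
Definition oracle (R : realType) (d : nat) : Type :=
  ('rV[R]_d -> R) -> 'rV[R]_d -> 'rV[R]_d.

(* By Rademacher's theorem [clarke f x] is nonempty for every Lipschitz f; the
   library does not have that theorem, hence the explicit guard. *)
Definition answers_clarke (R : realType) (d : nat) (O : oracle R d) : Prop :=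
  forall f x, (exists k, elipschitz k f) -> clarke f x !=set0 ->
    clarke f x (O f x).

(* The answer does not use global information: it is determined by the germ of
   the function at the queried point. *)
Definition local_oracle (R : realType) (d : nat) (O : oracle R d) : Prop :=
  forall f1 f2 x, (exists k, elipschitz k f1) -> (exists k, elipschitz k f2) ->
    (\forall y \near x, f1 y = f2 y) -> O f1 x = O f2 x.

Inductive action (R : realType) (d : nat) : Type :=
| Query of 'rV[R]_d
| Return of 'rV[R]_d.

(* The next action is computed from the initial point and the oracle answers
   received so far, oldest first; the earlier query points are themselves
   determined by these data. A run need not ever reach a [Return]. *)
Definition algorithm (R : realType) (d : nat) : Type :=
  'rV[R]_d -> seq 'rV[R]_d -> action R d.

(* The point returned after at most n further queries, if any, when [answers]
   have already been received and a query at q is answered by [g q]. *)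
Fixpoint output (R : realType) (d : nat) (A : algorithm R d) (x0 : 'rV[R]_d)
    (g : 'rV[R]_d -> 'rV[R]_d) (answers : seq 'rV[R]_d) (n : nat) :
    option 'rV[R]_d :=
  match A x0 answers with
  | Return x => Some x
  | Query q => if n is m.+1 then output A x0 g (rcons answers (g q)) m else None
  end.

Definition finds_goldstein (R : realType) (d : nat) (A : algorithm R d)
    (x0 : 'rV[R]_d) (O : oracle R d) (f : 'rV[R]_d -> R) (delta eps : R) :
    Prop :=
  exists n x, output A x0 (O f) [::] n = Some x /\
    goldstein_stationary delta eps f x.

(* Main.v *)
Require Import Defs.
From HB Require Import structures.
From mathcomp Require Import all_boot all_order all_algebra.
From mathcomp Require Import all_classical all_reals all_analysis.
From mathcomp Require Import lra.

Set Implicit Arguments.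
Unset Strict Implicit.
Unset Printing Implicit Defensive.

Import Order.TTheory GRing.Theory Num.Theory.
Import numFieldNormedType.Exports.

Local Open Scope classical_set_scope.
Local Open Scope ring_scope.

(* The oracle answers a fixed unit vector [e] whenever [e] is a Clarke
   subgradient at the queried point. Run the algorithm with constant answers
   [e]: the queries [q n] and the returned point [x] do not depend on the
   function. Take the ridge function [f y = h <e, y - x>], where [h] is
   1-Lipschitz with values in [-1, 1], is the identity on [-1, 1], and has
   derivative 1 arbitrarily close to each [<e, q n - x>]. Then [e] is a correct
   answer to every query, so the run for [f] is the run with constant answers,
   while [f] has gradient [e] on the open unit ball around [x], so that all
   Goldstein subgradients of [f] at [x] equal [e] and have norm 1. There may be
   infinitely many queries, dense in the line; [h] is made from the distribution
   function of Lebesgue measure on a small open set containing the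
   [<e, q n - x>] that lie outside [-1, 1]. *)

(** * Nonexpansive functions of one variable and germs of slope 1 *)

Definition nonexpansive (R : realType) (h : R -> R) :=
  forall a b, a <= b -> - (b - a) <= h b - h a <= b - a.

Lemma nonexpansive_max (R : realType) (g h : R -> R) :
  nonexpansive g -> nonexpansive h ->
  nonexpansive (fun s => Num.max (g s) (h s)).
Proof.
move=> Lg Lh a b ab; have := Lg a b ab; have := Lh a b ab.
by case: (lerP (g a) (h a)) => ?; case: (lerP (g b) (h b)) => ?; lra.
Qed.

Lemma nonexpansive_min (R : realType) (g h : R -> R) :
  nonexpansive g -> nonexpansive h ->
  nonexpansive (fun s => Num.min (g s) (h s)).
Proof.
move=> Lg Lh a b ab; have := Lg a b ab; have := Lh a b ab.
by case: (lerP (g a) (h a)) => ?; case: (lerP (g b) (h b)) => ?; lra.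
Qed.

(** Asked as a germ rather than as a derivative: maxima and minima of such germs are again
    translates of the identity, and gradients follow by locality. *)
Definition unit_slope_near (R : realType) (h : R -> R) (s : R) :=
  exists c, \forall r \near s, h r = r + c.

Lemma unit_slope_near_max (R : realType) (g h : R -> R) (s : R) :
  unit_slope_near g s -> unit_slope_near h s ->
  unit_slope_near (fun r => Num.max (g r) (h r)) s.
Proof.
move=> [c gc] [c' hc']; exists (Num.max c c'); near=> r.
by rewrite addr_maxr (near gc r) // (near hc' r).
Unshelve. all: by end_near. Qed.

Lemma unit_slope_near_min (R : realType) (g h : R -> R) (s : R) :
  unit_slope_near g s -> unit_slope_near h s ->
  unit_slope_near (fun r => Num.min (g r) (h r)) s.
Proof.
move=> [c gc] [c' hc']; exists (Num.min c c'); near=> r.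
by rewrite addr_minr (near gc r) // (near hc' r).
Unshelve. all: by end_near. Qed.

(** * A thin open subset of the line and the profile built from it *)

Local Notation mu := lebesgue_measure.

(* [v] is the distribution function of Lebesgue measure restricted to a union
   of balls around the [t n], shrinking fast with [n] and with the distance
   from [t n] to [-1, 1]; the radius is nonpositive when [`|t n| <= 1], which
   discards the ball. *)
Lemma exists_thin_distribution (R : realType) (t : nat -> R) :
  exists v : R -> R,
    [/\ forall a b, a <= b -> 0 <= v b - v a <= b - a,
        forall s, `|v s| <= 1,
        forall s k, 0 <= k -> `|s| <= 1 + k *+ 2 -> `|v s| <= k &
        forall n, 1 < `|t n| -> unit_slope_near v (t n)].
Proof.
pose m n : R := Num.min 1 (`|t n| - 1).
(* When [m n] is positive, the ball has length [m n / 8] divided by [2 ^ n.+1], a term dominated by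
   a geometric series. *)
pose rad n : R := m n / 16 / (2 ^ n.+1)%:R.
pose U := \bigcup_n (ball (t n) (rad n) : set R).
have p1 n : 1 <= (2 ^ n.+1)%:R :> R by rewrite ler1n expn_gt0.
have p0 n : 0 < (2 ^ n.+1)%:R :> R by rewrite ltr0n expn_gt0.
have m1 n : m n <= 1 by rewrite ge_min lexx.
have mt n : m n <= `|t n| - 1 by rewrite ge_min lexx orbT.
have mball n : measurable (ball (t n) (rad n) : set R).
  by rewrite ball_itv; exact: measurable_itv.
have mU : measurable U by apply: bigcup_measurable => n _; exact: mball.
have mIU (A : set R) : measurable A -> measurable (U `&` A).
  by move=> mA; exact: measurableI.
have rad0 n : m n <= 0 -> rad n <= 0.
  by move=> ?; rewrite /rad pmulr_lle0 ?invr_gt0 // pmulr_lle0 ?invr_gt0.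
(* Only balls that meet [A] contribute; each has length at most [k / 2 ^ n.+1], and these bounds sum
   to at most [k]. *)
have massI (A : set R) (k : R) : measurable A -> 0 <= k ->
    (forall n, 0 < m n -> ball (t n) (rad n) `&` A !=set0 -> m n / 8 <= k) ->
    (mu (U `&` A) <= k%:E)%E.
  move=> mA k0 Ak; rewrite /U setI_bigcupl.
  apply: le_trans (epsilon_trick0 xpredT k0).
  have mF n : measurable (ball (t n) (rad n) `&` A).
    by apply: measurableI.
  have mFU : measurable (\bigcup_n (ball (t n) (rad n) `&` A)).
    exact: bigcup_measurable.
  apply: le_trans (measure_sigma_subadditive mu mF mFU (@subset_refl _ _)) _.
  apply: lee_nneseries => // n _.
  have [r0|r0] := leP (m n) 0.
    rewrite (ball0 _ _).2 ?rad0 // set0I measure0 lee_fin.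
    by rewrite divr_ge0 // ltW.
  have [->|/set0P An] := eqVneq (ball (t n) (rad n) `&` A) set0.
    by rewrite measure0 lee_fin divr_ge0 // ltW.
  apply: (@le_trans _ _ (mu (ball (t n) (rad n)))).
    apply: le_measure; rewrite ?inE; [exact: mF|exact: mball|exact: subIsetl].
  rewrite lebesgue_measure_ball; last first.
    by rewrite !divr_ge0 // ltW.
  rewrite lee_fin -mulrnAl ler_pM2r ?invr_gt0 //.
  by have := Ak n r0 An; lra.
have mass1 (A : set R) : measurable A -> (mu (U `&` A) <= 1)%E.
  by move=> mA; apply: massI => // n _ _; have := m1 n; lra.
have massfin (A : set R) : measurable A -> mu (U `&` A) \is a fin_num.
  move=> mA; rewrite ge0_fin_numE //.
  by apply: le_lt_trans (mass1 _ mA) _; rewrite ltry.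
pose D s := fine (mu (U `&` `]-oo, s])).
have DB a b : a <= b -> D b - D a = fine (mu (U `&` `]a, b])).
  move=> ab; rewrite /D.
  have -> : U `&` `]-oo, b] = (U `&` `]-oo, a]) `|` (U `&` `]a, b]).
    rewrite -setIUr; congr (_ `&` _).
    apply/seteqP; split => x /=; rewrite !in_itv /=.
      by move=> xb; case: (leP x a) => ?; [left|right].
    by case=> [xa|/andP[]//]; exact: le_trans xa ab.
  rewrite measureU; [|exact: mIU|exact: mIU|].
    by rewrite fineD ?massfin // addrAC subrr add0r.
  apply/seteqP; split => // x [[_ /=]]; rewrite in_itv /= => xa.
  by move=> [_ /=]; rewrite in_itv /= ltNge xa.
have itv_mass (a b : R) : a <= b -> mu `]a, b] = (b - a)%:E.
  rewrite le_eqVlt => /predU1P[->|ab].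
    by rewrite set_itvoc0 // measure0 subrr.
  by rewrite lebesgue_measure_itv /= lte_fin ab EFinB.
have Dlip a b : a <= b -> 0 <= D b - D a <= b - a.
  move=> ab; rewrite DB // fine_ge0 //= -lee_fin fineK ?massfin //.
  rewrite -itv_mass //; apply: le_measure; last exact: subIsetr.
    by rewrite inE; exact: mIU.
  by rewrite inE; exact: measurable_itv.
have Dbnd s (k : R) : 0 <= k ->
    (forall A : set R, measurable A ->
      (forall x, A x -> `|x| <= `|s|) -> (mu (U `&` A) <= k%:E)%E) ->
    `|D s - D 0| <= k.
  move=> k0 H; have [s0|s0] := leP 0 s.
    rewrite DB // ger0_norm ?fine_ge0 // -lee_fin fineK ?massfin //.
    apply: H => // x /=; rewrite in_itv /= => /andP[x0 xs].
    by rewrite !ger0_norm // ltW.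
  rewrite distrC DB; last exact: ltW.
  rewrite ger0_norm ?fine_ge0 // -lee_fin fineK ?massfin //.
  apply: H => // x /=; rewrite in_itv /= => /andP[x0 xs].
  by rewrite (ltr0_norm s0) ler0_norm // lerN2 ltW.
exists (fun s => D s - D 0); split.
- by move=> a b /Dlip; lra.
- by move=> s; apply: Dbnd => // A mA _; exact: mass1.
- move=> s k k0 sk; apply: Dbnd => // A mA As; apply: massI => // n m0.
  move=> [x [/= tx /As xs]]; move: tx; rewrite -ball_normE /= => tx.
  have : `|t n| <= `|t n - x| + `|x| by rewrite -{1}(subrK x (t n)) ler_normD.
  have : rad n <= m n / 16.
    by rewrite /rad ler_pdivrMr // ler_peMr // divr_ge0 // ltW.
  (* Here [m n <= |t n| - 1 <= m n / 16 + 2 k], which forces [m n / 8 <= k]. *)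
  by have := mt n; lra.
- move=> n tn; have r0 : 0 < rad n.
    by rewrite !divr_gt0 // lt_min ltr01 subr_gt0.
  exists (D (t n) - D 0 - t n).
  (* The whole ball lies in [U], so mass is length there. *)
  have slope a b : a <= b -> ball (t n) (rad n) a -> ball (t n) (rad n) b ->
      D b - D a = b - a.
    rewrite -!ball_normE /= !ltr_distlC => ab aB bB.
    rewrite DB // (_ : U `&` `]a, b] = `]a, b]%classic) ?itv_mass //.
    apply/setIidPr => x /=; rewrite in_itv /= => xab; exists n => //.
    by rewrite -ball_normE /= ltr_distlC; lra.
  near=> r.
  have rB : ball (t n) (rad n) r by near: r; exact: nbhsx_ballx.
  have tB : ball (t n) (rad n) (t n) by exact: ballxx.
  have [tr|/ltW rt] := leP (t n) r.
    by have := slope _ _ tr tB rB; lra.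
  by have := slope _ _ rt rB tB; lra.
Unshelve. all: by end_near. Qed.

(* Beyond [1], [h] decreases from [1] with slope [-1], except on a thin set
   where it has slope [1], until it meets [v]; symmetrically below [-1]. *)
Lemma exists_resisting_profile (R : realType) (t : nat -> R) :
  exists h : R -> R,
    [/\ nonexpansive h,
        forall s, -1 <= h s <= 1,
        forall s, -1 <= s <= 1 -> h s = s &
        forall n (r : R), 0 < r ->
          exists s, `|s - t n| < r /\ unit_slope_near h s].
Proof.
have [v [vlip v1 vk vslope]] := exists_thin_distribution t.
(* Where [v] has slope 0 or 1, [v s *+ 2 - s] has slope -1 or 1. Since [v] vanishes on [-1, 1],
   [lower] meets the identity at -1 and [upper] meets it at 1. *)
pose lower s := v s *+ 2 - s - 2.
pose upper s := v s *+ 2 - s + 2.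
pose h s := Num.max (Num.min (lower s) (v s))
                    (Num.min s (Num.max (upper s) (v s))).
have h_id s : -1 <= s <= 1 -> h s = s.
  move=> s1; have : `|v s| <= 0.
    by apply: vk => //; rewrite mul0rn addr0 ler_norml.
  rewrite normr_le0 /h /lower /upper => /eqP ->; rewrite mul0rn sub0r.
  by case: (lerP (- s - 2)) => ?; case: (lerP (- s + 2)) => ?;
    case: (lerP s) => ?; case: lerP => ?; lra.
have vpos s : 0 <= s -> 0 <= v s.
  move=> /vlip; have := vk 0 0; rewrite normr0 mul0rn addr0.
  by move=> /(_ (lexx _) ler01); rewrite normr_le0 => /eqP ->; lra.
have vneg s : s <= 0 -> v s <= 0.
  move=> /vlip; have := vk 0 0; rewrite normr0 mul0rn addr0.
  by move=> /(_ (lexx _) ler01); rewrite normr_le0 => /eqP ->; lra.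
exists h; split => //.
- apply: nonexpansive_max; apply: nonexpansive_min.
  + by move=> a b /[dup] ab /vlip; rewrite /lower; lra.
  + by move=> a b /[dup] ab /vlip; lra.
  + by move=> a b; lra.
  + apply: nonexpansive_max.
      by move=> a b /[dup] ab /vlip; rewrite /upper; lra.
    by move=> a b /[dup] ab /vlip; lra.
- move=> s; have [s1|] := boolP (-1 <= s <= 1); first by rewrite h_id.
  move: (v1 s); rewrite negb_and -!ltNge ler_norml => v1s.
  case/orP => s1.
    (* This bound keeps [lower] at least -1; its mirror image below keeps [upper] at most 1. *)
    have : `|v s| <= (- s - 1) / 2.
      by apply: vk; [lra|rewrite ler0_norm; lra].
    have /vneg vs : s <= 0 by lra.
    rewrite ler_norml /h /lower /upper => vb.
    case: (lerP (v s *+ 2 - s - 2)) => ?; case: (lerP (v s *+ 2 - s + 2)) => ?;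
      case: (lerP s) => ?; rewrite maxEle; case: ifPn; rewrite -?ltNge; lra.
  have : `|v s| <= (s - 1) / 2.
    by apply: vk; [lra|rewrite ger0_norm; lra].
  have /vpos vs : 0 <= s by lra.
  rewrite ler_norml /h /lower /upper => vb.
  case: (lerP (v s *+ 2 - s - 2)) => ?; case: (lerP (v s *+ 2 - s + 2)) => ?;
    case: (lerP s) => ?; rewrite maxEle; case: ifPn; rewrite -?ltNge; lra.
- move=> n r r0; have [tn|tn] := leP `|t n| 1.
    have h_slope s : -1 < s < 1 -> unit_slope_near h s.
      move=> s1; exists 0; near=> x; rewrite addr0 h_id //.
      have : x \in `]-1, 1[ by near: x; exact: near_in_itvoo.
      by rewrite in_itv /=; lra.
    move: tn; rewrite ler_norml => tn.
    (* [t n] may be an endpoint of [-1, 1], where [h] may turn; a move by [q] towards 0 lands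
       strictly inside. *)
    pose q := Num.min (r / 2) (1 / 2).
    have q0 : 0 < q by rewrite lt_min; lra.
    have qr : q <= r / 2 by rewrite ge_min lexx.
    have q1 : q <= 1 / 2 by rewrite ge_min lexx orbT.
    have [t0|t0] := leP 0 (t n).
      exists (t n - q); split; last by apply: h_slope; lra.
      by rewrite ltr_norml; lra.
    exists (t n + q); split; last by apply: h_slope; lra.
    by rewrite ltr_norml; lra.
  exists (t n); split; first by rewrite subrr normr0.
  have [c vc] := vslope n tn.
  have slope_v : unit_slope_near v (t n) by exists c.
  (* All four pieces have slope 1 near [t n], so it does not matter which one is active. *)
  apply: unit_slope_near_max; apply: unit_slope_near_min => //.
  + exists (c *+ 2 - 2); near=> x.
    by rewrite /lower (near vc x) //; lra.
  + by exists 0; near=> x; rewrite addr0.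
  + apply: unit_slope_near_max => //; exists (c *+ 2 + 2); near=> x.
    by rewrite /upper (near vc x) //; lra.
Unshelve. all: by end_near. Qed.

(** * Locality and computation of Clarke subgradients *)

Lemma near_eq_differentiable (R : realType) (V W : normedModType R)
    (f g : V -> W) (x : V) :
  (\forall y \near x, f y = g y) -> differentiable f x -> differentiable g x.
Proof.
move=> fg; have fgx := nbhs_singleton fg.
move=> /diff_locallyP[df_cont /eqaddoP fE].
(* The remainder involves only values near [x], so the differential of [f] also expands [g]. *)
have gE : g \o shift x = cst (g x) + 'd f x +o_ 0 id.
  apply/eqaddoP => eps eps0; have := fE eps eps0.
  rewrite (near_shift 0) in fg; rewrite subr0 /= in fg.
  apply: filterS2 fg => y /= fgy.
  change (`|f (y + x) - (f x + 'd f x y)| <= eps * `|y| ->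
          `|g (y + x) - (g x + 'd f x y)| <= eps * `|y|).
  by rewrite fgy fgx.
apply: (iffRL (diff_locallyP _ _)).
by split; rewrite (diff_unique df_cont gE).
Qed.

Section clarke.
Context {R : realType} {d : nat}.
Implicit Types (f : 'rV[R]_d -> R) (x : 'rV[R]_d).

Lemma near_eq_gradient f1 f2 x :
  (\forall y \near x, f1 y = f2 y) -> gradient f1 x = gradient f2 x.
Proof. by move=> f12; apply/rowP => i; rewrite !mxE (near_eq_derive _ f12). Qed.

(** A neighbourhood of [x] is also one of every point close to [x], so a tail of the sequence [u]
    serves both functions. *)
Lemma near_eq_limiting_gradients f1 f2 x :
  (\forall y \near x, f1 y = f2 y) ->
  limiting_gradients f1 x `<=` limiting_gradients f2 x.
Proof.
move=> /near_join f12 g [u [f1u ux f1g]].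
have /= [N _ uN] := ux _ f12.
have f12u k : \forall y \near u (k + N)%N, f1 y = f2 y.
  by apply: uN => /=; rewrite leq_addl.
exists (fun k => u (k + N)%N); split.
- by move=> k; exact: near_eq_differentiable (f12u k) (f1u _).
- by move: ux; rewrite -(cvg_shiftn N).
- have -> : (fun k => gradient f2 (u (k + N)%N)) =
             (fun k => gradient f1 (u (k + N)%N)).
    by apply/funext => k; rewrite (near_eq_gradient (f12u k)).
  by move: f1g; rewrite -(cvg_shiftn N).
Qed.

Lemma near_eq_clarke f1 f2 x :
  (\forall y \near x, f1 y = f2 y) -> clarke f1 x = clarke f2 x.
Proof.
move=> f12; rewrite /clarke; congr conv_hull; apply/seteqP; split.
  exact: near_eq_limiting_gradients.
by apply: near_eq_limiting_gradients; apply: filterS f12.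
Qed.

Lemma coord_le_enorm x (i : 'I_d) : `|x 0 i| <= enorm x.
Proof.
rewrite -sqrtr_sqr /enorm ler_sqrt; last first.
  by apply: sumr_ge0 => j _; exact: sqr_ge0.
by rewrite (bigD1 i) //= lerDl; apply: sumr_ge0 => j _; exact: sqr_ge0.
Qed.

(** Hyperplanes confine the two nested hulls of the Goldstein subdifferential. *)
Lemma convex_coord_eq (i : 'I_d) (c : R) :
  convex_set [set g : 'rV[R]_d | g 0 i = c].
Proof.
move=> g g' l; rewrite !inE /= => gi g'i.
by rewrite /conv /= !mxE gi g'i -mulrDl addrC subrK mul1r.
Qed.

Lemma coord_differentiable_gradient f (i : 'I_d) (c : R) x :
  (\forall y \near x, f y = y 0 i + c) ->
  differentiable f x /\ gradient f x = delta_mx 0 i.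
Proof.
move=> fE.
have coordD : differentiable (fun y : 'rV[R]_d => y 0 i : R) x.
  exact: differentiable_coord.
have deriv_coord v : 'D_v (fun y : 'rV[R]_d => y 0 i : R) x = v 0 i.
  have idD : derivable (@id 'rV[R]_d) x v by exact: ex_derive.
  have := derive_mx idD.
  by rewrite derive_id => /matrixP/(_ 0 i); rewrite mxE.
have affD : differentiable (fun y : 'rV[R]_d => y 0 i + c) x.
  exact: differentiableD.
split; first by apply: near_eq_differentiable affD; apply: filterS fE.
rewrite (near_eq_gradient fE); apply/rowP => j; rewrite mxE.
rewrite (@deriveD _ _ _ (fun y : 'rV[R]_d => y 0 i : R) (cst c)).
- by rewrite derive_cst addr0 deriv_coord !mxE eq_sym.
- exact: diff_derivable.
- exact: derivable_cst.
Qed.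

Lemma limiting_gradients_coord f (i : 'I_d) (c : R) x :
  (\forall y \near x, f y = y 0 i + c) ->
  limiting_gradients f x `<=` [set delta_mx 0 i].
Proof.
move=> fE g /(near_eq_limiting_gradients fE)[u [_ _]].
rewrite (_ : (fun k => _) = (fun=> delta_mx 0 i)).
  by move=> eg; apply: (cvg_unique (@norm_hausdorff _ _) eg); exact: cvg_cst.
apply/funext => k.
have := @coord_differentiable_gradient (fun y => y 0 i + c) i c (u k).
by move=> []; first exact: filterE.
Qed.

(** All Clarke subgradients within [delta] of [x] have [i]-th coordinate 1; so do their convex
    combinations, whose norm is then at least 1. *)
Lemma not_goldstein_stationary_coord f (i : 'I_d) (c delta eps : R) x :
  (forall y, enorm (y - x) <= delta -> \forall z \near y, f z = z 0 i + c) ->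
  eps < 1 -> ~ goldstein_stationary delta eps f x.
Proof.
move=> fE eps1; rewrite /goldstein_stationary => /le_lt_trans.
move=> /(_ 1%:E); rewrite lte_fin => /(_ eps1); apply/negP; rewrite -leNgt.
apply: le_ereal_inf_tmp => _ [g gG <-]; rewrite lee_fin.
suff gi : g 0 i = 1 by rewrite -(@normr1 R) -gi coord_le_enorm.
move: g gG; apply: smallest_sub (@convex_coord_eq i 1) _ => g [y /= yx].
apply: smallest_sub (@convex_coord_eq i 1) _ g => g.
by move=> /(limiting_gradients_coord (fE y yx)) /= ->; rewrite mxE !eqxx.
Qed.

(** Moving [x] along the [i]-th axis brings the argument of [h] to a point [s] of unit slope, where
    the gradient is the basis vector; then [s] tends to [x 0 i - c]. *)
Lemma clarke_ridge (h : R -> R) (i : 'I_d) (c : R) x :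
  (forall r : R, 0 < r ->
    exists s, `|s - (x 0 i - c)| < r /\ unit_slope_near h s) ->
  clarke (fun y => h (y 0 i - c)) x (delta_mx 0 i).
Proof.
move=> hslope; apply: sub_gen_smallest.
have /choice[s sP] k : exists s, `|s - (x 0 i - c)| < k.+1%:R^-1 /\
    unit_slope_near h s by apply: hslope; rewrite invr_gt0.
pose u k := x + (s k - (x 0 i - c)) *: (delta_mx 0 i : 'rV[R]_d).
have grad k : differentiable (fun y : 'rV[R]_d => h (y 0 i - c)) (u k) /\
    gradient (fun y : 'rV[R]_d => h (y 0 i - c)) (u k) = delta_mx 0 i.
  have [_ [b hb]] := sP k; apply: (@coord_differentiable_gradient _ _ (b - c)).
  have coord_cvg : (y : 'rV[R]_d) 0 i - c @[y --> u k] --> s k.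
    have -> : s k = u k 0 i - c by rewrite /u !mxE !eqxx mulr1; lra.
    apply: (@cvgB _ _ _ (nbhs (u k))); last exact: cvg_cst.
    exact: (@coord_continuous R).
  near=> y; rewrite (_ : h (y 0 i - c) = y 0 i - c + b); first lra.
  by near: y; exact: coord_cvg _ hb.
exists u; split.
- by move=> k; have [] := grad k.
- rewrite -[X in _ --> X]addr0; apply: cvgD; first exact: cvg_cst.
  rewrite -(scale0r (delta_mx 0 i : 'rV[R]_d)); apply: cvgZr_tmp.
  apply/cvgr0Pnorm_lt => eps eps0; near=> k.
  have [/lt_trans sk _] := sP k; apply: sk.
  by near: k; exact: (near_infty_natSinv_lt (PosNum eps0)).
- rewrite (_ : (fun k => _) = (fun=> delta_mx 0 i)); first exact: cvg_cst.
  by apply/funext => k; have [] := grad k.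
Unshelve. all: by end_near. Qed.

End clarke.

(** * Runs of the algorithm under constant answers *)

Section algorithm.
Context {R : realType} {d : nat} (A : algorithm R d) (x0 : 'rV[R]_d).

Lemma output_unique g answers m n x y :
  output A x0 g answers m = Some x -> output A x0 g answers n = Some y -> x = y.
Proof.
elim: m n answers => [|m IH] [|n] answers /=; case: (A _ _) => // z;
  by [move=> [<-] [<-]|exact: IH].
Qed.

(* Junk value 0 when the run has returned before its query number [n]. *)
Definition const_query (e : 'rV[R]_d) (n : nat) : 'rV[R]_d :=
  if A x0 (nseq n e) is Query q then q else 0.

(** As long as all answers are [e], the next query is that of the constant run and is answered by
    [e] again; hence the induction generalises over the number [k] of answers received. *)
Lemma output_const_answers g e n :
  (forall k, g (const_query e k) = e) ->
  output A x0 g [::] n = output A x0 (fun=> e) [::] n.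
Proof.
move=> ge; suff eq_from k : output A x0 g (nseq k e) n =
    output A x0 (fun=> e) (nseq k e) n by exact: (eq_from 0%N).
elim: n k => [|n IH] k /=; first by case: (A _ _).
have := ge k; rewrite /const_query; case: (A _ _) => // q ->.
by rewrite -cats1 -(nseqD k 1) addn1 IH.
Qed.

End algorithm.

Theorem theorem5p1 (R : realType) (d : nat) (d_ge1 : (1 <= d)%N) :
  exists O : oracle R d,
    [/\ answers_clarke O, local_oracle O &
      forall (A : algorithm R d) (x0 : 'rV[R]_d),
        exists f : 'rV[R]_d -> R,
          [/\ elipschitz 1 f,
              forall x, -1 <= f x <= 1 &
              forall delta eps : R, 0 < delta -> delta < eps -> eps < 1 ->
                ~ finds_goldstein A x0 O f delta eps]].
Proof.
pose i0 : 'I_d := Ordinal d_ge1; pose e : 'rV[R]_d := delta_mx 0 i0.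
(* The choice looks at [f] only through [clarke f x], which is local. The default of [xget] occurs
   only when this set is empty. *)
pose O : oracle R d :=
  fun f x => if pselect (clarke f x e) then e else xget e (clarke f x).
exists O; split.
- move=> f x _ [g gx]; rewrite /O; case: pselect => // nfe.
  by apply: xgetPex; exists g.
- by move=> f1 f2 x _ _ f12; rewrite /O (near_eq_clarke f12).
move=> A x0.
(* The point returned by the constant run, fixed before [f] is built; it is 0 if that run never
   returns. *)
pose x := xget 0 [set x | exists n, output A x0 (fun=> e) [::] n = Some x].
have [h [hlip hbnd h_id hslope]] :=
  exists_resisting_profile (fun n => const_query A x0 e n 0 i0 - x 0 i0).
pose f (y : 'rV[R]_d) := h (y 0 i0 - x 0 i0).
have Oe n : O f (const_query A x0 e n) = e.
  have fe : clarke f (const_query A x0 e n) e.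
    by apply: clarke_ridge => r r0; exact: hslope.
  by rewrite /O; case: pselect.
exists f; split.
- move=> y z; rewrite mul1r; apply: le_trans (coord_le_enorm (y - z) i0).
  rewrite /f !mxE ler_norml; have [zy|/ltW yz] := leP (z 0 i0) (y 0 i0).
    rewrite ger0_norm ?subr_ge0 //.
    by have := hlip (z 0 i0 - x 0 i0) (y 0 i0 - x 0 i0); rewrite lerD2r; lra.
  rewrite ler0_norm ?subr_le0 //.
  by have := hlip (y 0 i0 - x 0 i0) (z 0 i0 - x 0 i0); rewrite lerD2r; lra.
- by move=> y; exact: hbnd.
move=> delta eps delta0 delta_eps eps1 [n [x']].
rewrite (output_const_answers n Oe) => -[out].
have -> : x' = x.
  have [m out'] : [set x | exists n, output A x0 (fun=> e) [::] n = Some x] x.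
    by apply: xgetPex; exists x', n.
  exact: output_unique out out'.
apply: (@not_goldstein_stationary_coord _ _ _ i0 (- x 0 i0)) => // y yx.
(* As [delta < eps < 1], the Goldstein ball projects into the interval where [h] is the identity. *)
have near_x : `|y 0 i0 - x 0 i0| < 1.
  apply: le_lt_trans (lt_trans delta_eps eps1); apply: le_trans yx.
  by have := coord_le_enorm (y - x) i0; rewrite !mxE.
have coord_cvg : (z : 'rV[R]_d) 0 i0 - x 0 i0 @[z --> y] --> y 0 i0 - x 0 i0.
  apply: (@cvgB _ _ _ (nbhs y)); last exact: cvg_cst.
  exact: (@coord_continuous R).
near=> z; apply: h_id.
have : `|z 0 i0 - x 0 i0| < 1.
  near: z; exact: cvgr_lt (cvg_norm coord_cvg) _ near_x.
by rewrite ltr_norml; lra.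
Unshelve. all: by end_near. Qed.
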